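(* Let $\Omega$ be a commutative semigroup with unit, $(A,* )$ an associative $H$-pseudoalgebra, $M$ an $A$-bimodule (both actions also denoted $*$) and $\{T_\alpha:M\to A\}_{\alpha\in\Omega}$ a pseudo-$\mathcal{O}$-operator family. For $\alpha,\beta\in\Omega$ define the $H^{\otimes 2}$-linear maps $$\triangleright_{\alpha,\beta}:M\otimes A\to H^{\otimes 2}\otimes_H A,\qquad u\triangleright_{\alpha,\beta}a=T_\alpha(u)*a-T_{\alpha\beta}(u*a),$$ $$\triangleleft_{\alpha,\beta}:A\otimes M\to H^{\otimes 2}\otimes_H A,\qquad a\triangleleft_{\alpha,\beta}u=a*T_\beta(u)-T_{\alpha\beta}(a*u).$$ Then $(A,\{\triangleright_{\alpha,\beta},\triangleleft_{\alpha,\beta}\}_{\alpha,\beta\in\Omega})$ is a bimodule over the $\Omega$-associative $H$-pseudoalgebra $(M,\{\widehat{*}_{\alpha,\beta}\}_{\alpha,\beta\in\Omega})$, where $u\,\widehat{*}_{\alpha,\beta}\,v=T_\alpha(u)*v+u*T_\beta(v)$ for $u,v\in M$.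
   Context: $k$ is an algebraically closed field of characteristic zero and $H$ is a cocommutative Hopf algebra over $k$ with comultiplication $\Delta$; $\otimes=\otimes_k$. For $n\ge 1$, $H^{\otimes n}$ is a right $H$-module via the iterated comultiplication, and for a left $H$-module $M$ the space $H^{\otimes n}\otimes_H M$ is a left $H^{\otimes n}$-module by left multiplication. A linear map $*: L\otimes M\to H^{\otimes 2}\otimes_H N$ (with $L,M,N$ left $H$-modules) is $H^{\otimes 2}$-linear if $fa*gb=((f\otimes g)\otimes_H 1)(a*b)$ for all $f,g\in H$. Such maps are composed as follows: if $x*y=\sum_i (f_i\otimes g_i)\otimes_H e_i$ and $F\in H^{\otimes 2}$, then $$(F\otimes_H x)*y=\sum_i (F\otimes 1)(\Delta\otimes \mathrm{id})(f_i\otimes g_i)\otimes_H e_i,\qquad x*(F\otimes_H y)=\sum_i (1\otimes F)(\mathrm{id}\otimes\Delta)(f_i\otimes g_i)\otimes_H e_i,$$ elements of $H^{\otimes 3}\otimes_H N$. An $H$-linear map $T:M\to N$ is applied to $H^{\otimes n}\otimes_H M$ as $\mathrm{id}\otimes_H T$. An associative $H$-pseudoalgebra is a left $H$-module $A$ with an $H^{\otimes 2}$-linear map $*:A\otimes A\to H^{\otimes 2}\otimes_H A$ with $(a*b)*c=a*(b*c)$. An $A$-bimodule is a left $H$-module $M$ with $H^{\otimes 2}$-linear maps $*:A\otimes M\to H^{\otimes 2}\otimes_H M$ and $*:M\otimes A\to H^{\otimes 2}\otimes_H M$ satisfying $a*(b*m)=(a*b)*m$, $m*(a*b)=(m*a)*b$,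 $(a*m)*b=a*(m*b)$ for $a,b\in A$, $m\in M$. A pseudo-$\mathcal{O}$-operator family (on $M$ over $A$) is a collection $\{T_\alpha:M\to A\}_{\alpha\in\Omega}$ of $H$-linear maps with $T_\alpha(u)*T_\beta(v)=T_{\alpha\beta}(T_\alpha(u)*v+u*T_\beta(v))$ for all $u,v\in M$, $\alpha,\beta\in\Omega$. An $\Omega$-associative $H$-pseudoalgebra is a left $H$-module $B$ with $H^{\otimes 2}$-linear maps $*_{\alpha,\beta}:B\otimes B\to H^{\otimes 2}\otimes_H B$ ($\alpha,\beta\in\Omega$) such that $(a*_{\alpha,\beta}b)*_{\alpha\beta,\gamma}c=a*_{\alpha,\beta\gamma}(b*_{\beta,\gamma}c)$ for all $a,b,c\in B$, $\alpha,\beta,\gamma\in\Omega$. A bimodule over it is a left $H$-module $N$ with $H^{\otimes 2}$-linear maps $B\otimes N\to H^{\otimes 2}\otimes_H N$, $(a,m)\mapsto a\cdot_{\alpha,\beta}m$, and $N\otimes B\to H^{\otimes 2}\otimes_H N$, $(m,a)\mapsto m\cdot_{\alpha,\beta}a$ ($\alpha,\beta\in\Omega$) such that for all $a,b\in B$, $m\in N$, $\alpha,\beta,\gamma\in\Omega$: $(a*_{\alpha,\beta}b)\cdot_{\alpha\beta,\gamma}m=a\cdot_{\alpha,\beta\gamma}(b\cdot_{\beta,\gamma}m)$, $(a\cdot_{\alpha,\beta}m)\cdot_{\alpha\beta,\gamma}b=a\cdot_{\alpha,\beta\gamma}(m\cdot_{\beta,\gamma}b)$, $(m\cdot_{\alpha,\beta}a)\cdot_{\alpha\beta,\gamma}b=m\cdot_{\alpha,\beta\gamma}(a*_{\beta,\gamma}b)$.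 In the claim, $\triangleright$ is the left action and $\triangleleft$ the right action of $B=M$ on $N=A$. *)

(* Defs.v *)
From HB Require Import structures.
From mathcomp Require Import all_boot ssralg.
From mathcomp Require Import boolp classical_sets.

Set Implicit Arguments.
Unset Strict Implicit.
Unset Printing Implicit Defensive.

Import GRing.Theory.
Local Open Scope ring_scope.
Local Open Scope quotient_scope.

Section BalancedTensor.

(* act is the right action of R on M; M is not packed as a right module because
   the right action of H on a tensor power of H depends on a comultiplication
   that is an ordinary parameter below. *)
Variables (R : pzRingType) (M : zmodType) (act : M -> R -> M) (N : lmodType R).

(* The tensor product of M and N over R by generators and relations: a list of
   pairs stands for the sum of the corresponding pure tensors. *)
Inductive tens_rel : seq (M * N) -> seq (M * N) -> Prop :=
  | TensRefl s : tens_rel s s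
  | TensSym s t : tens_rel s t -> tens_rel t s
  | TensTrans s t u : tens_rel s t -> tens_rel t u -> tens_rel s u
  | TensCat s s' t t' :
      tens_rel s s' -> tens_rel t t' -> tens_rel (s ++ t) (s' ++ t')
  | TensComm s t : tens_rel (s ++ t) (t ++ s)
  | TensZero n : tens_rel [:: (0, n)] [::]
  | TensAddL x y n : tens_rel [:: (x + y, n)] [:: (x, n); (y, n)]
  | TensAddR x n p : tens_rel [:: (x, n + p)] [:: (x, n); (x, p)]
  | TensBal x r n : tens_rel [:: (act x r, n)] [:: (x, r *: n)].

Definition tens_relb : rel (seq (M * N)) := fun s t => `[< tens_rel s t >].

Lemma tens_relb_refl : reflexive tens_relb.
Proof. by move=> s; apply/asboolP; exact: TensRefl. Qed.

Lemma tens_relb_sym : symmetric tens_relb.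
Proof. by move=> s t; apply/asboolP/asboolP => /TensSym. Qed.

Lemma tens_relb_trans : transitive tens_relb.
Proof.
by move=> t s u /asboolP st /asboolP tu; apply/asboolP; exact: TensTrans st tu.
Qed.

Definition tens_equiv :=
  EquivRel tens_relb tens_relb_refl tens_relb_sym tens_relb_trans.

Definition tens : Type := {eq_quot tens_equiv}.

HB.instance Definition _ := Choice.on tens.
HB.instance Definition _ := EqQuotient.on tens.

Lemma tens_eqP s t : reflect (\pi_tens s = \pi_tens t) `[< tens_rel s t >].
Proof. by apply: (iffP idP) => [st|/eqmodP//]; apply/eqmodP. Qed.

Lemma tens_pi s t : tens_rel s t -> \pi_tens s = \pi_tens t.
Proof. by move=> st; apply/tens_eqP/asboolP. Qed.

Lemma tens_surj (P : tens -> Prop) : (forall s, P (\pi_tens s)) -> forall z, P z.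
Proof. by move=> Ppi z; rewrite -[z]reprK; exact: Ppi. Qed.

Lemma tens_repr s : tens_rel (repr (\pi_tens s)) s.
Proof. by apply/asboolP/tens_eqP; rewrite reprK. Qed.

Definition tens_opps (s : seq (M * N)) := [seq (- p.1, p.2) | p <- s].

Definition tens_zero : tens := \pi_tens [::].
Definition tens_opp (z : tens) : tens := \pi_tens (tens_opps (repr z)).
Definition tens_add (z w : tens) : tens := \pi_tens (repr z ++ repr w).

Lemma tens_addE s t :
  tens_add (\pi_tens s) (\pi_tens t) = \pi_tens (s ++ t).
Proof. by apply: tens_pi; apply: TensCat; exact: tens_repr. Qed.

Lemma tens_addA : associative tens_add.
Proof.
by apply: tens_surj => s; apply: tens_surj => t; apply: tens_surj => u; rewrite !tens_addE catA.
Qed.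

Lemma tens_addC : commutative tens_add.
Proof.
by apply: tens_surj => s; apply: tens_surj => t; rewrite !tens_addE; exact/tens_pi/TensComm.
Qed.

Lemma tens_add0 : left_id tens_zero tens_add.
Proof. by apply: tens_surj => s; rewrite tens_addE. Qed.

Lemma tens_relN s : tens_rel (tens_opps s ++ s) [::].
Proof.
elim: s => [|[x n] s IHs] /=; first exact: TensRefl.
rewrite -/(tens_opps s).
change (tens_rel ([:: (- x, n)] ++ (tens_opps s ++ ([:: (x, n)] ++ s))) [::]).
apply: (@TensTrans _ ([:: (- x, n)] ++ (([:: (x, n)] ++ s) ++ tens_opps s))).
  by apply: TensCat (TensRefl _) (TensComm _ _).
have xNx : tens_rel ([:: (- x, n)] ++ [:: (x, n)]) [::].
  apply: TensTrans (TensSym (TensAddL _ _ _)) _.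
  by rewrite addNr; exact: TensZero.
rewrite -catA catA; apply: TensTrans (TensCat xNx (TensRefl _)) _.
exact: TensTrans (TensComm s (tens_opps s)) IHs.
Qed.

Lemma tens_addN : left_inverse tens_zero tens_opp tens_add.
Proof.
apply: tens_surj => s; rewrite /tens_opp tens_addE; apply: tens_pi.
apply: TensTrans (tens_relN (repr (\pi_tens s))).
by apply: TensCat (TensRefl _) (TensSym (tens_repr _)).
Qed.

HB.instance Definition _ := GRing.isZmodule.Build tens
  tens_addA tens_addC tens_add0 tens_addN.

Definition tens_pure (x : M) (n : N) : tens := \pi_tens [:: (x, n)].

Lemma tens_pureDl n : {morph tens_pure^~ n : x y / x + y}.
Proof.
move=> x y; rewrite [RHS]tens_addE; apply: tens_pi; exact: TensAddL.
Qed.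

Lemma tens_pureDr x : {morph tens_pure x : n p / n + p}.
Proof.
move=> n p; rewrite [RHS]tens_addE; apply: tens_pi; exact: TensAddR.
Qed.

Lemma tens_pureB x r n : tens_pure (act x r) n = tens_pure x (r *: n).
Proof. exact/tens_pi/TensBal. Qed.

Lemma tens_piE s : \pi_tens s = \sum_(p <- s) tens_pure p.1 p.2.
Proof.
elim: s => [|[x n] s IHs]; first by rewrite big_nil.
by rewrite big_cons -IHs [RHS]tens_addE.
Qed.

Lemma tens_ind (P : tens -> Prop) :
    (forall x n, P (tens_pure x n)) -> (forall z w, P z -> P w -> P (z + w)) ->
  forall z, P z.
Proof.
move=> Pp PD; apply: tens_surj => s; rewrite tens_piE.
elim: s => [|p s IHs]; last by rewrite big_cons; apply: PD.
have -> : \sum_(p <- [::]) tens_pure p.1 p.2 = tens_pure 0 0.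
  by rewrite big_nil; apply: (addIr (tens_pure 0 0)); rewrite -tens_pureDl addr0 add0r.
exact: Pp.
Qed.

Section Lift.

Variable G : zmodType.

Record balanced (f : M -> N -> G) : Prop := Balanced {
  balancedDl : forall n, {morph f^~ n : x y / x + y};
  balancedDr : forall x, {morph f x : n p / n + p};
  balancedB : forall x r n, f (act x r) n = f x (r *: n)
}.

(* The additive map sending the pure tensor of x and n to f x n; meaningful for
   balanced f, see tens_liftE. *)
Definition tens_lift (f : M -> N -> G) (z : tens) : G :=
  \sum_(p <- repr z) f p.1 p.2.

Variable f : M -> N -> G.
Hypothesis fbal : balanced f.

Lemma tens_lift_rel s t : tens_rel s t ->
  \sum_(p <- s) f p.1 p.2 = \sum_(p <- t) f p.1 p.2.
Proof.
elim=> {s t} //.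
- by move=> s t u _ -> _ ->.
- by move=> s s' t t' _ IHs _ IHt; rewrite !big_cat /= IHs IHt.
- by move=> s t; rewrite !big_cat /= addrC.
- move=> n; rewrite big_seq1 big_nil /=; apply: (addIr (f 0 n)).
  by rewrite -(balancedDl fbal) addr0 add0r.
- by move=> x y n; rewrite !big_cons !big_nil /= !addr0 (balancedDl fbal).
- by move=> x n p; rewrite !big_cons !big_nil /= !addr0 (balancedDr fbal).
- by move=> x r n; rewrite !big_seq1 /= (balancedB fbal).
Qed.

Lemma tens_lift_pi s : tens_lift f (\pi_tens s) = \sum_(p <- s) f p.1 p.2.
Proof. exact/tens_lift_rel/tens_repr. Qed.

Lemma tens_liftE x n : tens_lift f (tens_pure x n) = f x n.
Proof. by rewrite tens_lift_pi big_seq1. Qed.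

Lemma tens_liftD : {morph tens_lift f : z w / z + w}.
Proof.
apply: tens_surj => s; apply: tens_surj => t.
by rewrite [_ + _]tens_addE !tens_lift_pi big_cat.
Qed.

End Lift.

End BalancedTensor.

Section Separation.

Local Open Scope classical_set_scope.

Lemma separating_form (k : fieldType) (V : lmodType k) (v : V) : v != 0 ->
  exists2 l : V -> k, (forall c x y, l (c *: x + y) = c * l x + l y) & l v = 1.
Proof.
move=> v0.
pose P (W : set V) := (forall c x y, W x -> W y -> W (c *: x + y)) /\ ~ W v.
have [|W [[Wl Wv] Wmax]] := @Zorn_bigcup V P.
  move=> F FP Ftot; split=> [c x y [X FX Xx] [Y FY Yy]|[X FX Xv]]; last first.
    by have [_] := FP X FX; apply.
  have [XY|YX] := Ftot X Y FX FY.
  - by exists Y => //; have [h _] := FP Y FY; apply: h => //; exact: XY.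
  - by exists X => //; have [h _] := FP X FX; apply: h => //; exact: YX.
have W0 : W 0.
  apply: contrapT => nW0; pose B := W `|` [set 0].
  apply: (Wmax B).
    by split=> [x Wx|BW]; [left | apply: nW0; apply: BW; right].
  split=> [c x y [Wx|->] [Wy|->]|[//|/eqP]]; last by rewrite (negPf v0).
  - by left; exact: Wl.
  - by exfalso; apply: nW0; rewrite -(addNr x) -scaleN1r; exact: Wl.
  - by rewrite scaler0 add0r; left.
  - by right; rewrite scaler0 addr0.
have WZ c x : W x -> W (c *: x) by move=> Wx; rewrite -[_ *: _]addr0; exact: Wl.
have dec x : exists c, W (x - c *: v).
  apply: contrapT => nx.
  pose B := [set y | exists c, W (y - c *: x)].
  apply: (Wmax B); first split.
  - by move=> y Wy; exists 0; rewrite scale0r subr0.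
  - move=> BW; apply: nx; exists 0; rewrite scale0r subr0; apply: BW.
    by exists 1; rewrite scale1r subrr.
  split=> [c y z [a Wy] [b Wz]|[c Wc]].
    exists (c * a + b); rewrite scalerDl -scalerA opprD addrACA -scalerBr.
    exact: Wl.
  have [c0|c0] := eqVneq c 0; first by move: Wc; rewrite c0 scale0r subr0.
  apply: nx; exists c^-1; have := WZ (- c^-1) _ Wc.
  by rewrite scalerBr !scaleNr opprK scalerA mulVf // scale1r addrC.
pose l x := sval (cid (dec x)).
have lW x : W (x - l x *: v) by rewrite /l; case: (cid _).
have lu x c : W (x - c *: v) -> l x = c.
  move=> Wc; apply/eqP; rewrite -subr_eq0; apply/negP => /negP d0.
  apply: Wv; have := Wl (-1) _ _ (lW x) Wc.
  rewrite scaleN1r opprB addrA addrNK -scaleNr -scalerDl => /(WZ (l x - c)^-1).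
  by rewrite scalerA mulVf // scale1r.
exists l => [c x y|]; apply: lu; last by rewrite scale1r subrr.
by rewrite scalerDl -scalerA opprD addrACA -scalerBr; exact: Wl.
Qed.

End Separation.

Section TensorOverField.

Variable k : fieldType.
Implicit Types A B C : lmodType k.

Definition tensk A B : Type := tens (fun (x : A) (c : k) => c *: x) B.
HB.instance Definition _ A B := GRing.Zmodule.on (tensk A B).

Definition pure A B (x : A) (y : B) : tensk A B := tens_pure _ x y.
Local Notation "x ⊗ y" := (pure x y) (at level 40, left associativity).

Lemma pureDl A B (y : B) : {morph (@pure A B)^~ y : x x' / x + x'}.
Proof. exact: tens_pureDl. Qed.
Lemma pureDr A B (x : A) : {morph @pure A B x : y y' / y + y'}.
Proof. exact: tens_pureDr. Qed.
Lemma pureB A B c (x : A) (y : B) : (c *: x) ⊗ y = x ⊗ (c *: y).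
Proof. exact: tens_pureB. Qed.

Definition klift A B (G : zmodType) (f : A -> B -> G) : tensk A B -> G :=
  tens_lift f.

Record kbalanced A B (G : zmodType) (f : A -> B -> G) : Prop := KBalanced {
  kbalDl : forall y, {morph f^~ y : x x' / x + x'};
  kbalDr : forall x, {morph f x : y y' / y + y'};
  kbalB : forall c x y, f (c *: x) y = f x (c *: y)
}.

Section KLift.
Variables (A B : lmodType k) (G : zmodType) (f : A -> B -> G).
Hypothesis fbal : kbalanced f.

Let fb : balanced (fun (x : A) (c : k) => c *: x) f.
Proof. by case: fbal => fl fr fb; split=> // x c n; exact: fb. Qed.

Lemma kliftE x y : klift f (x ⊗ y) = f x y.
Proof. exact: tens_liftE fb _ _. Qed.

Lemma kliftD : {morph klift f : z w / z + w}.
Proof. exact: tens_liftD fb. Qed.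
End KLift.

Lemma tensk_ind A B (P : tensk A B -> Prop) :
    (forall x y, P (x ⊗ y)) -> (forall z w, P z -> P w -> P (z + w)) ->
  forall z, P z.
Proof. exact: tens_ind. Qed.

Section Scale.
Variables A B : lmodType k.

Definition tscale (c : k) : tensk A B -> tensk A B :=
  klift (fun x y => (c *: x) ⊗ y).

Lemma tscale_bal c : kbalanced (fun (x : A) (y : B) => (c *: x) ⊗ y).
Proof.
split=> [y x x'|x y y'|d x y]; first by rewrite scalerDr pureDl.
  by rewrite pureDr.
by rewrite scalerA mulrC -scalerA pureB.
Qed.

Lemma tscaleE c x y : tscale c (x ⊗ y) = (c *: x) ⊗ y.
Proof. exact: kliftE (tscale_bal c) _ _. Qed.

Lemma tscaleDr : right_distributive tscale +%R.
Proof. by move=> c; exact: kliftD (tscale_bal c). Qed.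

Lemma tscaleA a b z : tscale a (tscale b z) = tscale (a * b) z.
Proof.
elim/tensk_ind: z => [x y|z w IHz IHw]; last by rewrite !tscaleDr IHz IHw.
by rewrite !tscaleE scalerA.
Qed.

Lemma tscale1 : left_id 1 tscale.
Proof.
elim/tensk_ind=> [x y|z w IHz IHw]; last by rewrite tscaleDr IHz IHw.
by rewrite tscaleE scale1r.
Qed.

Lemma tscaleDl z : {morph tscale^~ z : a b / a + b}.
Proof.
move=> a b; elim/tensk_ind: z => [x y|z w IHz IHw].
  by rewrite !tscaleE scalerDl pureDl.
by rewrite !tscaleDr IHz IHw addrACA.
Qed.

HB.instance Definition _ :=
  GRing.Zmodule_isLmodule.Build k (tensk A B) tscaleA tscale1 tscaleDr tscaleDl.

Lemma pureZl c (x : A) (y : B) : (c *: x) ⊗ y = c *: (x ⊗ y).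
Proof. by rewrite [RHS]tscaleE. Qed.

Lemma pureZr c (x : A) (y : B) : x ⊗ (c *: y) = c *: (x ⊗ y).
Proof. by rewrite -pureB pureZl. Qed.
End Scale.

Lemma pure_bal A B : kbalanced (@pure A B).
Proof.
split=> [y|x|c x y]; [exact: pureDl | exact: pureDr | exact: pureB].
Qed.

Section BalancedScale.
(* k-bilinear maps into a k-module lift to k-linear maps. *)
Variables (A B V : lmodType k) (f : A -> B -> V).
Hypothesis fbal : kbalanced f.
Hypothesis fZ : forall c x y, f (c *: x) y = c *: f x y.

Lemma klift_linear : linear (klift f).
Proof.
move=> c z w; rewrite kliftD //; congr (_ + _).
elim/tensk_ind: z => [x y|z1 z2 IH1 IH2].
  by rewrite -pureZl !kliftE.
by rewrite scalerDr !kliftD // IH1 IH2 scalerDr.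
Qed.
End BalancedScale.

(* f (x) g *)
Definition tmap A B A' B' (f : A -> A') (g : B -> B') : tensk A B -> tensk A' B' :=
  klift (fun x y => f x ⊗ g y).

Section TMap.
Variables (A B A' B' : lmodType k) (f : {linear A -> A'}) (g : {linear B -> B'}).

Lemma tmap_bal : kbalanced (fun (x : A) (y : B) => f x ⊗ g y).
Proof.
by split=> [y x x'|x y y'|c x y]; rewrite ?linearD ?pureDl ?pureDr // !linearZ pureB.
Qed.

Lemma tmapE x y : tmap f g (x ⊗ y) = f x ⊗ g y.
Proof. exact: kliftE tmap_bal _ _. Qed.

Lemma tmap_linear : linear (tmap f g).
Proof.
apply: klift_linear tmap_bal _ => c x y /=.
by rewrite linearZ pureZl.
Qed.

HB.instance Definition _ :=
  GRing.isLinear.Build k (tensk A B) (tensk A' B') _ (tmap f g) tmap_linear.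
End TMap.

Definition tflip A B : tensk A B -> tensk B A := klift (fun x y => y ⊗ x).

Lemma tflipE A B (x : A) (y : B) : tflip (x ⊗ y) = y ⊗ x.
Proof.
apply: kliftE; split=> [z u v|z u v|c u v]; rewrite ?pureDl ?pureDr //.
by rewrite pureB.
Qed.

Definition tassoc A B C : tensk A (tensk B C) -> tensk (tensk A B) C :=
  klift (fun x => klift (fun y z => (x ⊗ y) ⊗ z)).

Section TAssoc.
Variables A B C : lmodType k.

Let assoc1_bal (x : A) : kbalanced (fun (y : B) (z : C) => (x ⊗ y) ⊗ z).
Proof.
split=> [z y y'|y z z'|c y z]; rewrite ?pureDr ?pureDl //.
by rewrite pureZr pureB.
Qed.

Let assoc_bal :
  kbalanced (fun (x : A) => klift (fun (y : B) (z : C) => (x ⊗ y) ⊗ z)).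
Proof.
split=> [w x x'|x|c x w].
- elim/tensk_ind: w => [y z|u v IHu IHv]; first by rewrite !kliftE // !pureDl.
  by rewrite !kliftD // IHu IHv addrACA.
- exact: kliftD.
- elim/tensk_ind: w => [y z|u v IHu IHv]; first by rewrite -pureZl !kliftE // pureB.
  by rewrite scalerDr !kliftD // IHu IHv.
Qed.

Lemma tassocE (x : A) (y : B) (z : C) : tassoc (x ⊗ (y ⊗ z)) = (x ⊗ y) ⊗ z.
Proof. by rewrite /tassoc !kliftE. Qed.

Lemma tassoc_linear : linear (@tassoc A B C).
Proof.
apply: klift_linear => // c x w; elim/tensk_ind: w => [y z|u v IHu IHv].
  by rewrite !kliftE // !pureZl.
by rewrite !kliftD // IHu IHv scalerDr.
Qed.

HB.instance Definition _ := GRing.isLinear.Build k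
  (tensk A (tensk B C)) (tensk (tensk A B) C) _ (@tassoc A B C) tassoc_linear.
End TAssoc.

Section TensorAlgebra.
Variables A B : algType k.

Definition tmul (z w : tensk A B) : tensk A B :=
  klift (fun a b => klift (fun a' b' => (a * a') ⊗ (b * b')) w) z.

Let mul1_bal (a : A) (b : B) :
  kbalanced (fun (a' : A) (b' : B) => (a * a') ⊗ (b * b')).
Proof.
split=> [y x x'|x y y'|c x y]; rewrite ?mulrDr ?pureDl ?pureDr //.
by rewrite -!scalerAr pureB.
Qed.

Let mul_bal (w : tensk A B) : kbalanced
  (fun (a : A) (b : B) => klift (fun (a' : A) (b' : B) => (a * a') ⊗ (b * b')) w).
Proof.
split=> [b a a'|a b b'|c a b]; elim/tensk_ind: w => [x y|u v IHu IHv].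
- by rewrite !kliftE // mulrDl pureDl.
- by rewrite !kliftD // IHu IHv addrACA.
- by rewrite !kliftE // mulrDl pureDr.
- by rewrite !kliftD // IHu IHv addrACA.
- by rewrite !kliftE // -!scalerAl pureB.
- by rewrite !kliftD // IHu IHv.
Qed.

Lemma tmulE a b a' b' : tmul (a ⊗ b) (a' ⊗ b') = (a * a') ⊗ (b * b').
Proof. by rewrite /tmul !kliftE. Qed.

Lemma tmulDl : left_distributive tmul +%R.
Proof. by move=> z z' w; rewrite /tmul kliftD. Qed.

Lemma tmulDr : right_distributive tmul +%R.
Proof.
move=> z w w'; elim/tensk_ind: z => [x y|u v IHu IHv].
  by rewrite /tmul !kliftE // kliftD.
by rewrite !tmulDl IHu IHv addrACA.
Qed.

Lemma tmulA : associative tmul.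
Proof.
move=> z w u; elim/tensk_ind: z => [a b|z1 z2 IH1 IH2]; last first.
  by rewrite !tmulDl IH1 IH2.
elim/tensk_ind: w => [a' b'|z1 z2 IH1 IH2]; last first.
  by rewrite !(tmulDl, tmulDr) IH1 IH2.
elim/tensk_ind: u => [a2 b2|z1 z2 IH1 IH2]; last first.
  by rewrite !tmulDr IH1 IH2.
by rewrite !tmulE !mulrA.
Qed.

Lemma tmul1l : left_id (1 ⊗ 1) tmul.
Proof.
elim/tensk_ind=> [x y|u v IHu IHv]; last by rewrite tmulDr IHu IHv.
by rewrite tmulE !mul1r.
Qed.

Lemma tmul1r : right_id (1 ⊗ 1) tmul.
Proof.
elim/tensk_ind=> [x y|u v IHu IHv]; last by rewrite tmulDl IHu IHv.
by rewrite tmulE !mulr1.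
Qed.

Lemma tone_neq0 : (1 ⊗ 1 : tensk A B) != 0.
Proof.
have [l ll l1] := separating_form (oner_neq0 A).
have lD : {morph l : x y / x + y}.
  by move=> x y; rewrite -[x]scale1r ll mul1r scale1r.
have l0 : l 0 = 0 by apply: (addIr (l 0)); rewrite -lD !add0r.
have lZ c x : l (c *: x) = c * l x by rewrite -[c *: x]addr0 ll l0 addr0.
have fbal : kbalanced (fun (a : A) (b : B) => l a *: b).
  split=> [y x x'|x y y'|c x y]; rewrite ?lD ?scalerDl ?scalerDr //.
  by rewrite lZ !scalerA mulrC.
apply/eqP => /(congr1 (klift (fun (a : A) (b : B) => l a *: b))).
rewrite kliftE // l1 scale1r => e.
suff k0 : klift (fun (a : A) (b : B) => l a *: b) 0 = 0.
  by move/eqP: e; rewrite k0 oner_eq0.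
by apply: (addIr (klift (fun (a : A) (b : B) => l a *: b) 0)); rewrite -kliftD // !add0r.
Qed.

HB.instance Definition _ := GRing.Zmodule_isNzRing.Build (tensk A B)
  tmulA tmul1l tmul1r tmulDl tmulDr tone_neq0.

Lemma pureM (a a' : A) (b b' : B) : (a ⊗ b) * (a' ⊗ b') = (a * a') ⊗ (b * b').
Proof. exact: tmulE. Qed.

Lemma tscaleAl (c : k) (z w : tensk A B) : c *: (z * w) = (c *: z) * w.
Proof.
elim/tensk_ind: z => [a b|z1 z2 IH1 IH2]; last first.
  by rewrite !(mulrDl, scalerDr) IH1 IH2.
elim/tensk_ind: w => [a' b'|z1 z2 IH1 IH2]; last first.
  by rewrite !(mulrDr, scalerDr) IH1 IH2.
by rewrite pureM -!pureZl pureM scalerAl.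
Qed.

Lemma tscaleAr (c : k) (z w : tensk A B) : c *: (z * w) = z * (c *: w).
Proof.
elim/tensk_ind: z => [a b|z1 z2 IH1 IH2]; last first.
  by rewrite !(mulrDl, scalerDr) IH1 IH2.
elim/tensk_ind: w => [a' b'|z1 z2 IH1 IH2]; last first.
  by rewrite !(mulrDr, scalerDr) IH1 IH2.
by rewrite pureM -!pureZl pureM scalerAr.
Qed.

HB.instance Definition _ :=
  GRing.Lmodule_isLalgebra.Build k (tensk A B) tscaleAl.
HB.instance Definition _ :=
  GRing.Lalgebra_isAlgebra.Build k (tensk A B) tscaleAr.

End TensorAlgebra.

Section TMapMultiplicative.
Variables (A B A' B' : algType k).
Variables (f : {lrmorphism A -> A'}) (g : {lrmorphism B -> B'}).

Lemma tmapM : {morph tmap f g : z w / z * w}.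
Proof.
move=> z w; elim/tensk_ind: z => [a b|z1 z2 IH1 IH2]; last first.
  by rewrite mulrDl !linearD mulrDl -IH1 -IH2.
elim/tensk_ind: w => [a' b'|z1 z2 IH1 IH2]; last first.
  by rewrite mulrDr !linearD mulrDr -IH1 -IH2.
by rewrite pureM !tmapE pureM !rmorphM.
Qed.
End TMapMultiplicative.

Lemma tassocM (A B C : algType k) :
  {morph @tassoc A B C : z w / z * w}.
Proof.
move=> z w; elim/tensk_ind: z => [a u|z1 z2 IH1 IH2]; last first.
  by rewrite mulrDl !linearD mulrDl -IH1 -IH2.
elim/tensk_ind: w => [a' u'|z1 z2 IH1 IH2]; last first.
  by rewrite mulrDr !linearD mulrDr -IH1 -IH2.
elim/tensk_ind: u => [b c|z1 z2 IH1 IH2]; last first.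
  by rewrite pureDr mulrDl !linearD mulrDl -IH1 -IH2.
elim/tensk_ind: u' => [b' c'|z1 z2 IH1 IH2]; last first.
  by rewrite pureDr mulrDr !linearD mulrDr -IH1 -IH2.
by rewrite !pureM !tassocE !pureM.
Qed.

End TensorOverField.

Notation "x ⊗ y" := (pure x y) (at level 40, left associativity) : ring_scope.

Record hopf (k : fieldType) (H : algType k) := Hopf {
  comul : {lrmorphism H -> tensk H H};
  counit : {lrmorphism H -> k^o};
  antipode : {linear H -> H};
  comul_coassoc : forall h,
    tmap comul idfun (comul h) = tassoc (tmap idfun comul (comul h));
  comul_counitl : forall h, klift (fun x y => (counit x : k) *: y) (comul h) = h;
  comul_counitr : forall h, klift (fun x y => (counit y : k) *: x) (comul h) = h;
  antipodel : forall h,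
    klift (fun x y => antipode x * y) (comul h) = (counit h : k)%:A;
  antipoder : forall h,
    klift (fun x y => x * antipode y) (comul h) = (counit h : k)%:A
}.

Definition cocommutative (k : fieldType) (H : algType k) (S : hopf H) : Prop :=
  forall h, tflip (comul S h) = comul S h.

Section ExtendedModule.

Variables (k : fieldType) (H : algType k).

(* X (x)_H N, where H acts on X on the right through d. *)
Definition ext (X : algType k) (d : H -> X) (N : lmodType H) : Type :=
  tens (fun (x : X) (h : H) => x * d h) N.
HB.instance Definition _ (X : algType k) (d : H -> X) N :=
  GRing.Zmodule.on (ext d N).

Definition extp (X : algType k) (d : H -> X) (N : lmodType H) (x : X) (n : N) :
  ext d N := tens_pure _ x n.

Section Ext.
Variables (X : algType k) (d : H -> X) (N : lmodType H).

Lemma extpDl (n : N) : {morph (@extp X d N)^~ n : x y / x + y}.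
Proof. exact: tens_pureDl. Qed.
Lemma extpDr (x : X) : {morph @extp X d N x : n p / n + p}.
Proof. exact: tens_pureDr. Qed.
Lemma extpB (x : X) h (n : N) : extp d (x * d h) n = extp d x (h *: n).
Proof. exact: tens_pureB. Qed.

Lemma ext_ind (P : ext d N -> Prop) :
    (forall x n, P (extp d x n)) -> (forall z w, P z -> P w -> P (z + w)) ->
  forall z, P z.
Proof. exact: tens_ind. Qed.

Definition extlift (G : zmodType) (f : X -> N -> G) : ext d N -> G := tens_lift f.

Record extbalanced (G : zmodType) (f : X -> N -> G) : Prop := ExtBalanced {
  extbalDl : forall n, {morph f^~ n : x y / x + y};
  extbalDr : forall x, {morph f x : n p / n + p};
  extbalB : forall x h n, f (x * d h) n = f x (h *: n)
}.

Section ExtLift.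
Variables (G : zmodType) (f : X -> N -> G).
Hypothesis fbal : extbalanced f.

Let fb : balanced (fun (x : X) (h : H) => x * d h) f.
Proof. by case: fbal. Qed.

Lemma extliftE x n : extlift f (extp d x n) = f x n.
Proof. exact: tens_liftE fb _ _. Qed.

Lemma extliftD : {morph extlift f : z w / z + w}.
Proof. exact: tens_liftD fb. Qed.
End ExtLift.

Definition extscale (x : X) : ext d N -> ext d N :=
  extlift (fun y n => extp d (x * y) n).

Let extscale_bal x : extbalanced (fun y n => extp d (x * y) n).
Proof.
split=> [n y z|y n p|y h n]; rewrite ?mulrDr ?extpDl ?extpDr //.
by rewrite mulrA extpB.
Qed.

Let extscaleE x y n : extscale x (extp d y n) = extp d (x * y) n.
Proof. exact: extliftE (extscale_bal x) _ _. Qed.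

Let extscaleDr : right_distributive extscale +%R.
Proof. by move=> x; exact: extliftD (extscale_bal x). Qed.

Let extscaleA x y z : extscale x (extscale y z) = extscale (x * y) z.
Proof.
elim/ext_ind: z => [u n|z w IHz IHw]; last by rewrite !extscaleDr IHz IHw.
by rewrite !extscaleE mulrA.
Qed.

Let extscale1 : left_id 1 extscale.
Proof.
elim/ext_ind=> [u n|z w IHz IHw]; last by rewrite extscaleDr IHz IHw.
by rewrite extscaleE mul1r.
Qed.

Let extscaleDl z : {morph extscale^~ z : x y / x + y}.
Proof.
move=> x y; elim/ext_ind: z => [u n|z w IHz IHw].
  by rewrite !extscaleE mulrDl extpDl.
by rewrite !extscaleDr IHz IHw addrACA.
Qed.

HB.instance Definition _ := GRing.Zmodule_isLmodule.Build X (ext d N)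
  extscaleA extscale1 extscaleDr extscaleDl.

Lemma extpZ x y n : x *: extp d y n = extp d (x * y) n.
Proof. exact: extscaleE. Qed.

End Ext.

(* phi (x)_H id and id (x)_H T; see extmaplE and extmaprE. *)
Definition extmapl (X Y : algType k) (d : H -> X) (e : H -> Y) (N : lmodType H)
    (phi : X -> Y) : ext d N -> ext e N :=
  extlift (fun x n => extp e (phi x) n).

Definition extmapr (X : algType k) (d : H -> X) (N P : lmodType H)
    (T : N -> P) : ext d N -> ext d P :=
  extlift (fun x n => extp d x (T n)).

Section ExtMap.
Variables (X Y : algType k) (d : H -> X) (e : H -> Y) (N P : lmodType H).

Section Left.
Variable phi : X -> Y.
Hypothesis phiD : {morph phi : x y / x + y}.
Hypothesis phid : forall x h, phi (x * d h) = phi x * e h.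

Let phi_bal : extbalanced d (fun x (n : N) => extp e (phi x) n).
Proof.
split=> [n x y|x n p|x h n]; rewrite ?phiD ?extpDl ?extpDr //.
by rewrite phid extpB.
Qed.

Lemma extmaplE x (n : N) : extmapl e phi (extp d x n) = extp e (phi x) n.
Proof. exact: extliftE phi_bal _ _. Qed.

Lemma extmaplD : {morph @extmapl X Y d e N phi : z w / z + w}.
Proof. exact: extliftD phi_bal. Qed.
End Left.

Section Right.
Variable T : {linear N -> P}.

Let T_bal : extbalanced d (fun x (n : N) => extp d x (T n)).
Proof.
split=> [n x y|x n p|x h n]; rewrite ?linearD ?extpDl ?extpDr //.
by rewrite linearZ extpB.
Qed.

Lemma extmaprE x (n : N) : extmapr T (extp d x n) = extp d x (T n).
Proof. exact: extliftE T_bal _ _. Qed.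

Lemma extmaprD : {morph @extmapr X d N P T : z w / z + w}.
Proof. exact: extliftD T_bal. Qed.
End Right.
End ExtMap.

End ExtendedModule.

Section Pseudoalgebra.

Variables (k : fieldType) (H : algType k) (S : hopf H).
Implicit Types A B L M N : lmodType H.

Local Notation H2 := (tensk H H).
Local Notation H3 := (tensk (tensk H H) H).
Local Notation Delta := (comul S).

Definition comul3 (h : H) : H3 := tmap Delta idfun (Delta h).

Definition ext2 N := ext Delta N.
Definition ext3 N := ext comul3 N.
HB.instance Definition _ N := GRing.Lmodule.on (ext2 N).
HB.instance Definition _ N := GRing.Lmodule.on (ext3 N).

(* A linear map from the tensor product of L and M over k is given as a
   k-bilinear map; k-homogeneity is the case f = c%:A, g = 1 (or f = 1,
   g = c%:A) of the last clause, k acting on L and M through H. *)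
Definition pseudolinear L M N (op : L -> M -> ext2 N) : Prop :=
  [/\ forall b, {morph op^~ b : a a' / a + a'},
      forall a, {morph op a : b b' / b + b'} &
      forall f g a b, op (f *: a) (g *: b) = (f ⊗ g) *: op a b].

(* The composites (F (x)_H x) * y and x * (F (x)_H y). The threefold tensor
   power is bracketed to the left, hence tassoc in rcomp. Both are well defined
   for pseudolinear op: see lcompE and rcompE. *)
Definition lcomp L M N (op : L -> M -> ext2 N) (z : ext2 L) (y : M) : ext3 N :=
  extlift (fun (F : H2) x =>
    extmapl comul3 (fun X : H2 => (F ⊗ 1) * tmap Delta idfun X) (op x y)) z.

Definition rcomp L M N (op : L -> M -> ext2 N) (x : L) (z : ext2 M) : ext3 N :=
  extlift (fun (F : H2) y =>
    extmapl comul3 (fun X : H2 => tassoc ((1 ⊗ F) * tmap idfun Delta X)) (op x y)) z.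

Section Composition.
Variables (L M N : lmodType H) (op : L -> M -> ext2 N).
Hypothesis opP : pseudolinear op.

Let lphiD (F : H2) :
  {morph (fun X : H2 => (F ⊗ 1 : H3) * tmap Delta idfun X) : X Y / X + Y}.
Proof. by move=> X Y; rewrite linearD mulrDr. Qed.

Let lphid (F : H2) (X : H2) h :
  (F ⊗ 1 : H3) * tmap Delta idfun (X * Delta h) =
  (F ⊗ 1) * tmap Delta idfun X * comul3 h.
Proof. by rewrite tmapM mulrA. Qed.

Let rphiD (F : H2) :
  {morph (fun X : H2 => tassoc ((1 ⊗ F) * tmap idfun Delta X)) : X Y / X + Y}.
Proof. by move=> X Y; rewrite linearD mulrDr linearD. Qed.

Let rphid (F : H2) (X : H2) h :
  tassoc ((1 ⊗ F) * tmap idfun Delta (X * Delta h)) =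
  tassoc ((1 ⊗ F) * tmap idfun Delta X) * comul3 h.
Proof.
rewrite (tmapM idfun Delta X (Delta h)) mulrA.
rewrite (tassocM ((1 ⊗ F) * tmap idfun Delta X) (tmap idfun Delta (Delta h))).
by rewrite /comul3 comul_coassoc.
Qed.

Let lop (y : M) (F : H2) (x : L) : ext3 N :=
  extmapl comul3 (fun X : H2 => (F ⊗ 1) * tmap Delta idfun X) (op x y).

Let rop (x : L) (F : H2) (y : M) : ext3 N :=
  extmapl comul3 (fun X : H2 => tassoc ((1 ⊗ F) * tmap idfun Delta X)) (op x y).

Let lop_bal y : extbalanced Delta (lop y).
Proof.
have [opl opr opZ] := opP.
split=> [x F F'|F x x'|F h x]; rewrite /lop.
- elim/ext_ind: (op x y) => [X n|z w IHz IHw].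
    by rewrite !extmaplE // pureDl mulrDl extpDl.
  by rewrite !extmaplD // IHz IHw addrACA.
- by rewrite opl extmaplD.
- rewrite -[y in RHS]scale1r opZ.
  elim/ext_ind: (op x y) => [X n|z w IHz IHw].
    by rewrite extpZ !extmaplE // tmapM tmapE mulrA pureM mulr1.
  by rewrite scalerDr !extmaplD // IHz IHw.
Qed.

Let rop_bal x : extbalanced Delta (rop x).
Proof.
have [opl opr opZ] := opP.
split=> [y F F'|F y y'|F h y]; rewrite /rop.
- elim/ext_ind: (op x y) => [X n|z w IHz IHw].
    by rewrite !extmaplE // pureDr mulrDl linearD extpDl.
  by rewrite !extmaplD // IHz IHw addrACA.
- by rewrite opr extmaplD.
- rewrite -[x in RHS]scale1r opZ.
  elim/ext_ind: (op x y) => [X n|z w IHz IHw].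
    by rewrite extpZ !extmaplE // tmapM tmapE mulrA pureM mulr1.
  by rewrite scalerDr !extmaplD // IHz IHw.
Qed.

Lemma lcompD y : {morph (lcomp op)^~ y : z w / z + w}.
Proof. exact: extliftD (lop_bal y). Qed.

Lemma rcompD x : {morph rcomp op x : z w / z + w}.
Proof. exact: extliftD (rop_bal x). Qed.

Lemma lcompE I (r : seq I) (f g : I -> H) (e : I -> N) F x y :
    op x y = \sum_(i <- r) extp Delta (f i ⊗ g i) (e i) ->
  lcomp op (extp Delta F x) y =
  \sum_(i <- r)
    extp comul3 ((F ⊗ 1) * tmap Delta idfun (f i ⊗ g i)) (e i).
Proof.
move=> opE; rewrite /lcomp (extliftE (lop_bal y)) /lop opE.
elim: r {opE} => [|i r IHr]; last first.
  by rewrite !big_cons extmaplD // IHr extmaplE.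
rewrite !big_nil; apply: (addIr (extmapl comul3
  (fun X : H2 => (F ⊗ 1) * tmap Delta idfun X) (0 : ext2 N))).
by rewrite -extmaplD // !add0r.
Qed.

Lemma rcompE I (r : seq I) (f g : I -> H) (e : I -> N) F x y :
    op x y = \sum_(i <- r) extp Delta (f i ⊗ g i) (e i) ->
  rcomp op x (extp Delta F y) =
  \sum_(i <- r)
    extp comul3 (tassoc ((1 ⊗ F) * tmap idfun Delta (f i ⊗ g i))) (e i).
Proof.
move=> opE; rewrite /rcomp (extliftE (rop_bal x)) /rop opE.
elim: r {opE} => [|i r IHr]; last first.
  by rewrite !big_cons extmaplD // IHr extmaplE.
rewrite !big_nil; apply: (addIr (extmapl comul3
  (fun X : H2 => tassoc ((1 ⊗ F) * tmap idfun Delta X)) (0 : ext2 N))).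
by rewrite -extmaplD // !add0r.
Qed.

End Composition.

Definition is_assoc_pseudoalgebra A (mu : A -> A -> ext2 A) : Prop :=
  pseudolinear mu /\
  forall a b c, lcomp mu (mu a b) c = rcomp mu a (mu b c).

Record is_pseudobimodule A (mu : A -> A -> ext2 A) M
    (l : A -> M -> ext2 M) (r : M -> A -> ext2 M) : Prop := IsPseudobimodule {
  pbim_l : pseudolinear l;
  pbim_r : pseudolinear r;
  pbim_ll : forall a b m, rcomp l a (l b m) = lcomp l (mu a b) m;
  pbim_rr : forall m a b, rcomp r m (mu a b) = lcomp r (r m a) b;
  pbim_lr : forall a m b, lcomp r (l a m) b = rcomp l a (r m b)
}.

Section Omega.

Variable Omega : semigroupType.
Implicit Types alpha beta gamma : Omega.

Definition is_O_operator_family A (mu : A -> A -> ext2 A) M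
    (l : A -> M -> ext2 M) (r : M -> A -> ext2 M)
    (T : Omega -> {linear M -> A}) : Prop :=
  forall alpha beta u v,
    mu (T alpha u) (T beta v) =
    extmapr (T (alpha * beta)%g) (l (T alpha u) v + r u (T beta v)).

Record is_Omega_assoc_pseudoalgebra B (mu : Omega -> Omega -> B -> B -> ext2 B) :
    Prop := IsOmegaAssocPseudoalgebra {
  Opsa_lin : forall alpha beta, pseudolinear (mu alpha beta);
  Opsa_assoc : forall alpha beta gamma a b c,
    lcomp (mu (alpha * beta)%g gamma) (mu alpha beta a b) c =
    rcomp (mu alpha (beta * gamma)%g) a (mu beta gamma b c)
}.

Record is_Omega_pseudobimodule B (mu : Omega -> Omega -> B -> B -> ext2 B) N
    (l : Omega -> Omega -> B -> N -> ext2 N)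
    (r : Omega -> Omega -> N -> B -> ext2 N) : Prop := IsOmegaPseudobimodule {
  Obim_l : forall alpha beta, pseudolinear (l alpha beta);
  Obim_r : forall alpha beta, pseudolinear (r alpha beta);
  Obim_ll : forall alpha beta gamma a b m,
    lcomp (l (alpha * beta)%g gamma) (mu alpha beta a b) m =
    rcomp (l alpha (beta * gamma)%g) a (l beta gamma b m);
  Obim_lr : forall alpha beta gamma a m b,
    lcomp (r (alpha * beta)%g gamma) (l alpha beta a m) b =
    rcomp (l alpha (beta * gamma)%g) a (r beta gamma m b);
  Obim_rr : forall alpha beta gamma m a b,
    lcomp (r (alpha * beta)%g gamma) (r alpha beta m a) b =
    rcomp (r alpha (beta * gamma)%g) m (mu beta gamma a b)
}.

Section OperatorFamily.

Variables (A M : lmodType H) (mu : A -> A -> ext2 A).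
Variables (l : A -> M -> ext2 M) (r : M -> A -> ext2 M).
Variable T : Omega -> {linear M -> A}.

(* On M: the product, and the left and right actions of M on A. *)
Definition hat_prod alpha beta (u v : M) : ext2 M :=
  l (T alpha u) v + r u (T beta v).

Definition tri_left alpha beta (u : M) (a : A) : ext2 A :=
  mu (T alpha u) a - extmapr (T (alpha * beta)%g) (r u a).

Definition tri_right alpha beta (a : A) (u : M) : ext2 A :=
  mu a (T beta u) - extmapr (T (alpha * beta)%g) (l a u).

End OperatorFamily.

End Omega.

End Pseudoalgebra.

(* Main.v *)
Require Import Defs.
From HB Require Import structures.
From mathcomp Require Import all_boot ssralg.

(* T is linear and so passes through both composites; hence the defining
   identity of the family also holds with u or v replaced by elements of the
   twofold extensions. Substituting it, every axiom of the Omega-structures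
   becomes a signed sum of the axioms of A and of the bimodule M, some of them
   under T. *)

Set Implicit Arguments.
Unset Strict Implicit.
Unset Printing Implicit Defensive.

Import GRing.Theory.
Local Open Scope ring_scope.

(** * Additive maps between extended modules *)

Section ExtMapAdditivity.
Variables (k : fieldType) (H : algType k).

Lemma morphD0 (U V : zmodType) (f : U -> V) :
  {morph f : x y / x + y} -> f 0 = 0.
Proof. by move=> fD; apply: (addIr (f 0)); rewrite -fD !add0r. Qed.

Lemma morphDN (U V : zmodType) (f : U -> V) :
  {morph f : x y / x + y} -> {morph f : x / - x}.
Proof.
by move=> fD x; apply: (addIr (f x)); rewrite -fD !addNr; exact: morphD0.
Qed.

Lemma morphDB (U V : zmodType) (f : U -> V) :
  {morph f : x y / x + y} -> {morph f : x y / x - y}.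
Proof. by move=> fD x y; rewrite fD (morphDN fD). Qed.

Lemma extmaprZ (X : algType k) (d : H -> X) (N P : lmodType H)
    (T : {linear N -> P}) x (z : ext d N) :
  extmapr T (x *: z) = x *: extmapr T z.
Proof.
elim/ext_ind: z => [y n|z w IHz IHw]; first by rewrite extpZ !extmaprE extpZ.
by rewrite scalerDr !extmaprD scalerDr IHz IHw.
Qed.

(** The two maps act on different tensor factors; the hypotheses on [phi] make [extmapl] well
    defined on the balanced tensor product. *)
Lemma extmapr_extmapl (X Y : algType k) (d : H -> X) (e : H -> Y)
    (N P : lmodType H) (phi : X -> Y) (T : {linear N -> P}) (z : ext d N) :
    {morph phi : x y / x + y} ->
    (forall x h, phi (x * d h) = phi x * e h) ->
  extmapr T (extmapl e phi z) = extmapl e phi (extmapr T z).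
Proof.
move=> phiD phid; elim/ext_ind: z => [x n|z w IHz IHw].
  by rewrite extmaplE // !extmaprE extmaplE.
by rewrite extmaplD // !extmaprD extmaplD // IHz IHw.
Qed.

End ExtMapAdditivity.

(** * How the two composites react to changing the operation *)

Section Composites.
Variables (k : fieldType) (H : algType k) (S : hopf H).
Implicit Types L M N P : lmodType H.
Local Notation H2 := (tensk H H).
Local Notation H3 := (tensk (tensk H H) H).
Local Notation Delta := (comul S).

(** [lphi] and [rphi] are convertible to the coefficient maps inside [lcomp] and [rcomp]; naming
    them allows their additivity and their compatibility with the coproduct to be fed to the lemmas
    on [extmapl]. *)
Definition lphi (F : H2) : H2 -> H3 :=
  fun X => (pure F 1 : H3) * tmap Delta idfun X.

Definition rphi (F : H2) : H2 -> H3 :=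
  fun X => tassoc ((pure 1 F) * tmap idfun Delta X).

Lemma lphiD F : {morph lphi F : X Y / X + Y}.
Proof. by move=> X Y; rewrite /lphi linearD mulrDr. Qed.

Lemma rphiD F : {morph rphi F : X Y / X + Y}.
Proof. by move=> X Y; rewrite /rphi linearD mulrDr linearD. Qed.

Lemma lphid F X h : lphi F (X * Delta h) = lphi F X * comul3 S h.
Proof. by rewrite /lphi tmapM mulrA. Qed.

(** Coassociativity enters here: [comul3] splits the left factor, whereas [rphi] splits the right
    one. *)
Lemma rphid F X h : rphi F (X * Delta h) = rphi F X * comul3 S h.
Proof.
rewrite /rphi (tmapM idfun Delta X (Delta h)) mulrA.
rewrite (tassocM (pure 1 F * tmap idfun Delta X) (tmap idfun Delta (Delta h))).
by rewrite /comul3 comul_coassoc.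
Qed.

(** Provides the presentations that [lcompE] and [rcompE] take as input. *)
Lemma ext2_sum N (z : ext2 S N) : exists s : seq (H * H * N),
  z = \sum_(p <- s) extp Delta (pure p.1.1 p.1.2) p.2.
Proof.
elim/ext_ind: z => [x n|z w [s ->] [t ->]]; last by exists (s ++ t); rewrite big_cat.
elim/tensk_ind: x => [f g|z w [s zE] [t wE]].
  by exists [:: (f, g, n)]; rewrite big_seq1.
by exists (s ++ t); rewrite big_cat extpDl zE wE.
Qed.

Section OneOp.
Variables (L M N : lmodType H) (op : L -> M -> ext2 S N).

Section Pure.
Hypothesis opP : pseudolinear op.

(** Choosing a presentation of [op x y], applying [lcompE] and folding the sum back gives a formula
    free of that choice. *)
Lemma lcomp_extp F x y :
  lcomp op (extp Delta F x) y = extmapl (comul3 S) (lphi F) (op x y).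
Proof.
have [s sE] := ext2_sum (op x y); rewrite (lcompE opP _ sE) sE.
have fD := extmaplD (N := N) (lphiD F) (lphid F).
rewrite (big_morph _ fD (morphD0 fD)).
by apply: eq_bigr => p _; rewrite (extmaplE (lphiD F) (lphid F)).
Qed.

Lemma rcomp_extp F x y :
  rcomp op x (extp Delta F y) = extmapl (comul3 S) (rphi F) (op x y).
Proof.
have [s sE] := ext2_sum (op x y); rewrite (rcompE opP _ sE) sE.
have fD := extmaplD (N := N) (rphiD F) (rphid F).
rewrite (big_morph _ fD (morphD0 fD)).
by apply: eq_bigr => p _; rewrite (extmaplE (rphiD F) (rphid F)).
Qed.

End Pure.

(** Both composites are sums over the same representative of [z], so [T] can be moved out term by
    term. *)
Lemma lcomp_post P (T : {linear N -> P}) z y :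
  lcomp (fun x y => extmapr T (op x y)) z y = extmapr T (lcomp op z y).
Proof.
have TD := extmaprD (d := comul3 S) T.
rewrite /lcomp /extlift /tens_lift (big_morph _ TD (morphD0 TD)).
by apply: eq_bigr => p _; rewrite (extmapr_extmapl _ _ (lphiD p.1) (lphid p.1)).
Qed.

Lemma rcomp_post P (T : {linear N -> P}) x z :
  rcomp (fun x y => extmapr T (op x y)) x z = extmapr T (rcomp op x z).
Proof.
have TD := extmaprD (d := comul3 S) T.
rewrite /rcomp /extlift /tens_lift (big_morph _ TD (morphD0 TD)).
by apply: eq_bigr => p _; rewrite (extmapr_extmapl _ _ (rphiD p.1) (rphid p.1)).
Qed.

Lemma pseudolinear_post P (T : {linear N -> P}) :
  pseudolinear op -> pseudolinear (fun x y => extmapr T (op x y)).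
Proof.
case=> opl opr opZ; split=> [b x y|a x y|f g a b].
- by rewrite opl extmaprD.
- by rewrite opr extmaprD.
- by rewrite opZ extmaprZ.
Qed.

Lemma pseudolinear_prel P (T : {linear P -> L}) :
  pseudolinear op -> pseudolinear (fun x y => op (T x) y).
Proof.
case=> opl opr opZ; split=> [b x y|a x y|f g a b].
- by rewrite linearD opl.
- by rewrite opr.
- by rewrite linearZ opZ.
Qed.

Lemma pseudolinear_prer P (T : {linear P -> M}) :
  pseudolinear op -> pseudolinear (fun x y => op x (T y)).
Proof.
case=> opl opr opZ; split=> [b x y|a x y|f g a b].
- by rewrite opl.
- by rewrite linearD opr.
- by rewrite linearZ opZ.
Qed.

End OneOp.

Section Precomposition.
Variables (L M N P : lmodType H) (op : L -> M -> ext2 S N).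
Hypothesis opP : pseudolinear op.

(** The chosen representatives of [z] and [extmapr T z] are unrelated, so a termwise comparison
    fails; the identity is checked on pure tensors and extended by additivity of the composites. *)
Lemma lcomp_prel (T : {linear P -> L}) z y :
  lcomp (fun x y => op (T x) y) z y = lcomp op (extmapr T z) y.
Proof.
have opTP : pseudolinear (fun x y => op (T x) y).
  exact: pseudolinear_prel.
move: z; apply: ext_ind => [F x|z w IHz IHw].
  by rewrite extmaprE (lcomp_extp opTP) (lcomp_extp opP).
by rewrite extmaprD (lcompD opTP) (lcompD opP) IHz IHw.
Qed.

Lemma rcomp_prer (T : {linear P -> M}) x z :
  rcomp (fun x y => op x (T y)) x z = rcomp op x (extmapr T z).
Proof.
have opTP : pseudolinear (fun x y => op x (T y)).
  exact: pseudolinear_prer.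
move: z; apply: ext_ind => [F y|z w IHz IHw].
  by rewrite extmaprE (rcomp_extp opTP) (rcomp_extp opP).
by rewrite extmaprD (rcompD opTP) (rcompD opP) IHz IHw.
Qed.

End Precomposition.

Section TwoOps.
Variables (L M N : lmodType H) (op1 op2 : L -> M -> ext2 S N).

Lemma lcomp_addop z y :
  lcomp (fun x y => op1 x y + op2 x y) z y = lcomp op1 z y + lcomp op2 z y.
Proof.
rewrite /lcomp /extlift /tens_lift -big_split /=; apply: eq_bigr => p _.
exact: extmaplD (lphiD p.1) (lphid p.1) _ _.
Qed.

Lemma rcomp_addop x z :
  rcomp (fun x y => op1 x y + op2 x y) x z = rcomp op1 x z + rcomp op2 x z.
Proof.
rewrite /rcomp /extlift /tens_lift -big_split /=; apply: eq_bigr => p _.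
exact: extmaplD (rphiD p.1) (rphid p.1) _ _.
Qed.

Lemma lcomp_subop z y :
  lcomp (fun x y => op1 x y - op2 x y) z y = lcomp op1 z y - lcomp op2 z y.
Proof.
rewrite /lcomp /extlift /tens_lift -sumrB; apply: eq_bigr => p _.
exact: morphDB (extmaplD (lphiD p.1) (lphid p.1)) _ _.
Qed.

Lemma rcomp_subop x z :
  rcomp (fun x y => op1 x y - op2 x y) x z = rcomp op1 x z - rcomp op2 x z.
Proof.
rewrite /rcomp /extlift /tens_lift -sumrB; apply: eq_bigr => p _.
exact: morphDB (extmaplD (rphiD p.1) (rphid p.1)) _ _.
Qed.

Hypotheses (op1P : pseudolinear op1) (op2P : pseudolinear op2).

Lemma pseudolinearD : pseudolinear (fun x y => op1 x y + op2 x y).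
Proof.
have [l1 r1 z1] := op1P; have [l2 r2 z2] := op2P.
split=> [b x y|a x y|f g a b].
- by rewrite l1 l2 addrACA.
- by rewrite r1 r2 addrACA.
- by rewrite z1 z2 scalerDr.
Qed.

Lemma pseudolinearB : pseudolinear (fun x y => op1 x y - op2 x y).
Proof.
have [l1 r1 z1] := op1P; have [l2 r2 z2] := op2P.
split=> [b x y|a x y|f g a b].
- by rewrite l1 l2 opprD addrACA.
- by rewrite r1 r2 opprD addrACA.
- by rewrite z1 z2 scalerBr.
Qed.

End TwoOps.

Lemma lcompB L M N (op : L -> M -> ext2 S N) y :
  pseudolinear op -> {morph (lcomp op)^~ y : z w / z - w}.
Proof. by move=> opP; apply: morphDB; exact: lcompD. Qed.

Lemma rcompB L M N (op : L -> M -> ext2 S N) x :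
  pseudolinear op -> {morph rcomp op x : z w / z - w}.
Proof. by move=> opP; apply: morphDB; exact: rcompD. Qed.

(** * Composites of the operations built from an operator family *)

Section OperatorFamily.
Variables (Omega : semigroupType) (A M : lmodType H) (mu : A -> A -> ext2 S A).
Variables (l : A -> M -> ext2 S M) (r : M -> A -> ext2 S M).
Variable T : Omega -> {linear M -> A}.
Hypotheses (muP : is_assoc_pseudoalgebra mu) (MP : is_pseudobimodule mu l r).
Hypothesis TP : is_O_operator_family mu l r T.

Let mul : pseudolinear mu := proj1 muP.
Let muA : forall a b c, lcomp mu (mu a b) c = rcomp mu a (mu b c) := proj2 muP.
Let ll : pseudolinear l := pbim_l MP.
Let rl : pseudolinear r := pbim_r MP.

(** In the summand with [r], [T beta] acts on the argument that is not extended, so only conversion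
    is needed there; [lcomp_prel] handles the summand with [l]. *)
Lemma lcomp_hat alpha beta z v :
  lcomp (hat_prod l r T alpha beta) z v =
  lcomp l (extmapr (T alpha) z) v + lcomp r z (T beta v).
Proof. by rewrite [LHS]lcomp_addop lcomp_prel. Qed.

Lemma rcomp_hat alpha beta u z :
  rcomp (hat_prod l r T alpha beta) u z =
  rcomp l (T alpha u) z + rcomp r u (extmapr (T beta) z).
Proof. by rewrite [LHS]rcomp_addop rcomp_prer. Qed.

Lemma lcomp_tri_left alpha beta z a :
  lcomp (tri_left mu r T alpha beta) z a =
  lcomp mu (extmapr (T alpha) z) a - extmapr (T (alpha * beta)%g) (lcomp r z a).
Proof. by rewrite [LHS]lcomp_subop lcomp_prel // lcomp_post. Qed.

Lemma rcomp_tri_left alpha beta u z :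
  rcomp (tri_left mu r T alpha beta) u z =
  rcomp mu (T alpha u) z - extmapr (T (alpha * beta)%g) (rcomp r u z).
Proof. by rewrite [LHS]rcomp_subop rcomp_post. Qed.

Lemma lcomp_tri_right alpha beta z u :
  lcomp (tri_right mu l T alpha beta) z u =
  lcomp mu z (T beta u) - extmapr (T (alpha * beta)%g) (lcomp l z u).
Proof. by rewrite [LHS]lcomp_subop lcomp_post. Qed.

Lemma rcomp_tri_right alpha beta a z :
  rcomp (tri_right mu l T alpha beta) a z =
  rcomp mu a (extmapr (T beta) z) - extmapr (T (alpha * beta)%g) (rcomp l a z).
Proof. by rewrite [LHS]rcomp_subop rcomp_prer // rcomp_post. Qed.

Lemma extmapr_hat alpha beta u v :
  extmapr (T (alpha * beta)%g) (hat_prod l r T alpha beta u v) =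
  mu (T alpha u) (T beta v).
Proof. by rewrite TP. Qed.

Let TD gamma (z w : ext3 S M) :
  extmapr (T gamma) (z + w) = extmapr (T gamma) z + extmapr (T gamma) w.
Proof. exact: extmaprD. Qed.

(** In the uses below, [s] is a composite with [T] applied inside: it arises once from the operator
    identity and once, with the opposite sign, from the correction term of the inner action. *)
Let cancelr gamma (x : ext3 S A) (p q s : ext3 S M) :
  x - extmapr (T gamma) (p + s) - extmapr (T gamma) (q - s) =
  x - extmapr (T gamma) (p + q).
Proof. by rewrite -addrA -opprD -TD addrACA subrr addr0. Qed.

Let cancell gamma (x : ext3 S A) (p q s : ext3 S M) :
  x - extmapr (T gamma) (s + p) - extmapr (T gamma) (q - s) =
  x - extmapr (T gamma) (q + p).
Proof. by rewrite [s + p]addrC cancelr [p + q]addrC. Qed.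

(** The operator identity with its first argument extended. *)
Lemma lcomp_O alpha beta z v :
  lcomp mu (extmapr (T alpha) z) (T beta v) =
  extmapr (T (alpha * beta)%g)
    (lcomp l (extmapr (T alpha) z) v + lcomp r z (T beta v)).
Proof.
(* Both sides become composites over the same [z], of operations that agree pointwise by the
   operator identity. *)
rewrite -lcomp_hat -lcomp_post -lcomp_prel // /lcomp /extlift /tens_lift.
by apply: eq_bigr => p _; rewrite extmapr_hat.
Qed.

Lemma rcomp_O alpha beta u z :
  rcomp mu (T alpha u) (extmapr (T beta) z) =
  extmapr (T (alpha * beta)%g)
    (rcomp l (T alpha u) z + rcomp r u (extmapr (T beta) z)).
Proof.
rewrite -rcomp_hat -rcomp_post -rcomp_prer // /rcomp /extlift /tens_lift.
by apply: eq_bigr => p _; rewrite extmapr_hat.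
Qed.

Lemma pseudolinear_hat alpha beta : pseudolinear (hat_prod l r T alpha beta).
Proof.
exact: pseudolinearD (pseudolinear_prel (T alpha) ll)
                     (pseudolinear_prer (T beta) rl).
Qed.

Lemma pseudolinear_tri_left alpha beta :
  pseudolinear (tri_left mu r T alpha beta).
Proof.
exact: pseudolinearB (pseudolinear_prel (T alpha) mul)
                     (pseudolinear_post (T (alpha * beta)%g) rl).
Qed.

Lemma pseudolinear_tri_right alpha beta :
  pseudolinear (tri_right mu l T alpha beta).
Proof.
exact: pseudolinearB (pseudolinear_prer (T beta) mul)
                     (pseudolinear_post (T (alpha * beta)%g) ll).
Qed.

(** * The associativity and bimodule axioms *)

Lemma hat_prod_assoc : is_Omega_assoc_pseudoalgebra (hat_prod l r T).
Proof.
split=> [|alpha beta gamma u v w]; first exact: pseudolinear_hat.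
rewrite lcomp_hat rcomp_hat (extmapr_hat alpha beta) (extmapr_hat beta gamma).
rewrite /hat_prod (lcompD rl) (rcompD ll).
(* Each side has three terms, matched one by one by the three bimodule axioms of [M]. *)
by rewrite (pbim_ll MP) (pbim_lr MP) (pbim_rr MP) addrA.
Qed.

Lemma tri_pseudobimodule :
  is_Omega_pseudobimodule (hat_prod l r T) (tri_left mu r T) (tri_right mu l T).
Proof.
split; [exact: pseudolinear_tri_left | exact: pseudolinear_tri_right | | |].
- move=> alpha beta gamma u v a.
  rewrite lcomp_tri_left rcomp_tri_left (extmapr_hat alpha beta).
  rewrite /hat_prod /tri_left (lcompD rl) (rcompB _ mul) (rcompB _ rl).
  rewrite rcomp_O muA (pbim_lr MP) (pbim_rr MP) -mulgA.
  (* The term cancelled is [rcomp r (u) (extmapr (T (beta * gamma)) (r v a))], on the right-hand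
     side only. *)
  by rewrite cancelr.
- move=> alpha beta gamma u a v.
  rewrite lcomp_tri_right rcomp_tri_left /tri_left /tri_right.
  rewrite (lcompB _ mul) (lcompB _ ll) (rcompB _ mul) (rcompB _ rl).
  rewrite lcomp_O rcomp_O muA (pbim_rr MP) (pbim_ll MP) -mulgA.
  (* Here the inner action is corrected on both sides: [cancell] removes the composite of [l] with
     [extmapr (T (alpha * beta)) (r u a)] on the left, [cancelr] that of [r] with
     [extmapr (T (beta * gamma)) (l a v)] on the right. *)
  by rewrite cancell cancelr.
- move=> alpha beta gamma a u v.
  rewrite lcomp_tri_right rcomp_tri_right (extmapr_hat beta gamma).
  rewrite /hat_prod /tri_right (rcompD ll) (lcompB _ mul) (lcompB _ ll).
  rewrite lcomp_O muA (pbim_lr MP) (pbim_ll MP) -mulgA.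
  (* Only the left-hand side has a nested action; the term removed is the composite of [l] with
     [extmapr (T (alpha * beta)) (l a u)]. *)
  by rewrite cancell.
Qed.

End OperatorFamily.
End Composites.

Theorem theorem4p3 (k : closedFieldType) (char0 : [pchar k] =i pred0)
    (H : algType k) (S : hopf H) (cocommS : cocommutative S)
    (Omega : monoidType)
    (OmegaC : forall alpha beta : Omega, (alpha * beta = beta * alpha)%g)
    (A : lmodType H) (mu : A -> A -> ext2 S A)
    (muP : is_assoc_pseudoalgebra mu)
    (M : lmodType H) (l : A -> M -> ext2 S M) (r : M -> A -> ext2 S M)
    (MP : is_pseudobimodule mu l r)
    (T : Omega -> {linear M -> A}) (TP : is_O_operator_family mu l r T) :
  is_Omega_assoc_pseudoalgebra (hat_prod l r T) /\
  is_Omega_pseudobimodule (hat_prod l r T) (tri_left mu r T) (tri_right mu l T).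
Proof.
split; [exact: hat_prod_assoc MP TP | exact: tri_pseudobimodule muP MP TP].
Qed.
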